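(* In the setting described in the context, for every integer $n\ge 0$, $$N_p(k_n)=\int f\,\rho^{(n)}_F(f\,|\,\boldsymbol{\sigma}_\ominus)\,df\,d\lambda_p^{(n)}(\boldsymbol{\sigma}_\ominus),$$ where $$d\lambda_p^{(n)}(\boldsymbol{\sigma}_\ominus)=\frac{c_n}{k_n^p}\Big(\prod_{j=1}^n\sigma_{-j}^{p-1}\Big)d\nu^{(n)}_\ominus(\boldsymbol{\sigma}_\ominus),\qquad c_n=\prod_{j=1}^n\int A\circ g\,d\nu^{(j-1)}$$ (empty products equal $1$). Moreover $\lambda_p^{(0)}=\nu^{(0)}_\ominus$ and, for all $n\ge0$, $$d\lambda_p^{(n+1)}(\boldsymbol{\sigma}_\ominus)=2^{-p}\sigma_{-1}^p\,\rho_0^{(n+1)}(\sigma_0\,|\,\boldsymbol{\sigma}_-)\,d\sigma_0\,d\Lambda_p^{(n)}(\boldsymbol{\sigma}_-),\qquad \Lambda_p^{(n)}=\mathbf{S}_\sharp\lambda_p^{(n)}.$$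
   Context: Let $(\mathcal{X},\Sigma)$ be a measurable space, $\Phi^t$ ($t\in\mathbb{R}$) a flow (bijective measurable maps, $\Phi^{t_1}\circ\Phi^{t_2}=\Phi^{t_1+t_2}$, jointly measurable in $(x,t)$), and $\mu$ an invariant probability measure ($\Phi^t_\sharp\mu=\mu$ for all $t$, where $f_\sharp$ denotes push-forward). Let $h^a$, $a>0$, be bijective measurable maps of $\mathcal{X}$ and $\mathcal{G}$ a group of bijective measurable maps of $\mathcal{X}$ such that $h^{a_1}\circ h^{a_2}=h^{a_1a_2}$, $\Phi^t\circ g=g\circ\Phi^t$, $g\circ h^a=h^a\circ g$, $\Phi^t\circ h^a=h^a\circ\Phi^{t/a}$ for all $a,a_1,a_2>0$, $t$, $g\in\mathcal{G}$. Let $\mathcal{Y}\subset\mathcal{X}$ be a representative set: for every $x$ there is a unique $a=A(x)>0$ with $h^a(x)\in\mathcal{Y}$, where $A:\mathcal{X}\to(0,\infty)$ is measurable with $\int A\,d\mu<\infty$; let $P(x)=h^{A(x)}(x)$. Note $A\circ h^a=A/a$ and $A=1$ on $\mathcal{Y}$. For a measure $\rho$ and positive measurable $B$ with $0<\int B\,d\rho<\infty$, $\rho_B$ is the probability measure with $d\rho_B/d\rho=B/\int B\,d\rho$. Let $\nu=P_\sharp\mu_A$. Standing assumption: $\int A\circ g'\,d\mu<\infty$ for every $g'\in\mathcal{G}$. For $g'\in\mathcal{G}$ and a probability measure $\rho$ on $\mathcal{Y}$ with $\int A\circ g'\,d\rho<\infty$ set $g'_\star\rho=(P\circ g')_\sharp\rho_{A\circ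 g'}$. Fix $g\in\mathcal{G}$ and $p\in\mathbb{R}$. Let $\nu^{(n)}=(g^n)_\star\nu$ for $n\ge0$ (so $\nu^{(0)}=\nu$). Let $F:\mathcal{X}\to\mathbb{R}$ be measurable with $F\circ h^a=F/a^p$ for all $a>0$. With $k_n=2^n$, define $N_p(k_n)=k_n^{-p}\int F\circ g^n\,d\nu$. Multipliers: $\sigma_n(y)=A(g^{n+1}(y))/A(g^n(y))$ for $n\in\mathbb{Z}$, $y\in\mathcal{Y}$. Let $\mathcal{S}_-=(0,\infty)^{\mathbb{N}}$ with the product topology; write $\boldsymbol{\sigma}_-=(\sigma_{-1},\sigma_{-2},\dots)\in\mathcal{S}_-$, $\boldsymbol{\sigma}_\ominus=(\sigma_0,\boldsymbol{\sigma}_-)\in(0,\infty)\times\mathcal{S}_-$, $\boldsymbol{\phi}=(f,\boldsymbol{\sigma}_\ominus)\in\mathbb{R}\times(0,\infty)\times\mathcal{S}_-$. Define maps $\mathbf{P}_-(y)=(\sigma_{-1}(y),\sigma_{-2}(y),\dots)$, $\mathbf{P}_\ominus(y)=(\sigma_0(y),\sigma_{-1}(y),\dots)$, $\mathbf{P}_\phi(y)=(F(y),\sigma_0(y),\sigma_{-1}(y),\dots)$, and the shift $\mathbf{S}:(0,\infty)\times\mathcal{S}_-\to\mathcal{S}_-$, $\mathbf{S}(\sigma_0,\sigma_{-1},\sigma_{-2},\dots)=(\sigma_0,\sigma_{-1},\dots)$ viewed as $(\sigma'_{-1},\sigma'_{-2},\dots)$ with $\sigma'_n=\sigma_{n+1}$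 for $n<0$. Let $\nu^{(n)}_-=(\mathbf{P}_-)_\sharp\nu^{(n)}$, $\nu^{(n)}_\ominus=(\mathbf{P}_\ominus)_\sharp\nu^{(n)}$, $\nu^{(n)}_\phi=(\mathbf{P}_\phi)_\sharp\nu^{(n)}$. Assume there exist measurable conditional densities $\rho^{(n)}_0(\sigma_0|\boldsymbol{\sigma}_-)$ and $\rho^{(n)}_F(f|\boldsymbol{\sigma}_\ominus)$ with $d\nu^{(n)}_\ominus(\boldsymbol{\sigma}_\ominus)=\rho^{(n)}_0(\sigma_0|\boldsymbol{\sigma}_-)\,d\sigma_0\,d\nu^{(n)}_-(\boldsymbol{\sigma}_-)$ and $d\nu^{(n)}_\phi(\boldsymbol{\phi})=\rho^{(n)}_F(f|\boldsymbol{\sigma}_\ominus)\,df\,d\nu^{(n)}_\ominus(\boldsymbol{\sigma}_\ominus)$. *)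

(* Defs.v *)
From HB Require Import structures.
From mathcomp Require Import all_boot all_order all_algebra.
From mathcomp Require Import all_classical all_reals all_analysis.
Set Implicit Arguments. Unset Strict Implicit. Unset Printing Implicit Defensive.
Import Order.TTheory GRing.Theory Num.Theory.
Import numFieldNormedType.Exports.
Local Open Scope classical_set_scope.
Local Open Scope ring_scope.

(* Sequences are modelled as [nat -> R]; index j stands for sigma_{-(j+1)}.
   The sigma-algebra is the product sigma-algebra generated by the coordinate
   maps (= Borel sigma-algebra of the product topology, as R is second
   countable).  The measures considered are concentrated on positive
   sequences. *)
Definition coord (R : realType) (i : nat) (s : nat -> R) : R := s i.

Definition coord_sets (R : realType) : set (set (nat -> R)) :=
  fun E => exists (i : nat) (B : set R), measurable B /\ E = coord i @^-1` B.

Definition seqR (R : realType) := g_sigma_algebraType (@coord_sets R).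

Definition shiftS (R : realType) (z : R * seqR R) : seqR R :=
  fun j => if j is j'.+1 then z.2 j' else z.1.

Definition is_group_of_bij_meas d (X : measurableType d) (G : set (X -> X)) :=
  [/\ G id,
      (forall g1 g2, G g1 -> G g2 -> G (g1 \o g2)),
      (forall g1, G g1 -> exists2 g2, G g2 & cancel g1 g2 /\ cancel g2 g1) &
      (forall g1, G g1 -> bijective g1 /\ measurable_fun setT g1)].

Definition gpow (X : Type) (g ginv : X -> X) (k : int) : X -> X :=
  match k with Posz n => iter n g | Negz n => iter n.+1 ginv end.

Definition dens d (X : measurableType d) (R : realType)
  (rho : set X -> \bar R) (B : X -> R) : set X -> \bar R :=
  fun E => (((fine (\int[rho]_x (B x)%:E))^-1)%:E * \int[rho]_(x in E) (B x)%:E)%E.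

Definition gstar d (X : measurableType d) (R : realType)
  (A : X -> R) (P : X -> X) (g' : X -> X) (rho : set X -> \bar R) : set X -> \bar R :=
  pushforward (dens rho (A \o g')) (P \o g').

Definition Pmap (X : Type) (R : realType) (h : R -> X -> X) (A : X -> R) : X -> X :=
  fun x => h (A x) x.

Definition nu0 d (X : measurableType d) (R : realType)
  (mu : set X -> \bar R) (h : R -> X -> X) (A : X -> R) : set X -> \bar R :=
  pushforward (dens mu A) (Pmap h A).

Definition nun d (X : measurableType d) (R : realType)
  (mu : set X -> \bar R) (h : R -> X -> X) (A : X -> R) (g : X -> X) (n : nat)
  : set X -> \bar R :=
  gstar A (Pmap h A) (iter n g) (nu0 mu h A).

Definition sigmaZ (X : Type) (R : realType) (A : X -> R) (g ginv : X -> X)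
  (k : int) (y : X) : R :=
  A (gpow g ginv (k + 1) y) / A (gpow g ginv k y).

Definition Pminus (X : Type) (R : realType) (A : X -> R) (g ginv : X -> X)
  (y : X) : seqR R :=
  fun j => sigmaZ A g ginv (- (Posz j.+1)) y.

Definition Pominus (X : Type) (R : realType) (A : X -> R) (g ginv : X -> X)
  (y : X) : R * seqR R :=
  (sigmaZ A g ginv 0 y, Pminus A g ginv y).

Definition Pphi (X : Type) (R : realType) (F : X -> R) (A : X -> R)
  (g ginv : X -> X) (y : X) : R * (R * seqR R) :=
  (F y, Pominus A g ginv y).

Definition nu_minus d (X : measurableType d) (R : realType)
  (mu : set X -> \bar R) (h : R -> X -> X) (A : X -> R) (g ginv : X -> X)
  (n : nat) : set (seqR R) -> \bar R :=
  pushforward (nun mu h A g n) (Pminus A g ginv).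

Definition nu_ominus d (X : measurableType d) (R : realType)
  (mu : set X -> \bar R) (h : R -> X -> X) (A : X -> R) (g ginv : X -> X)
  (n : nat) : set (R * seqR R) -> \bar R :=
  pushforward (nun mu h A g n) (Pominus A g ginv).

Definition nu_phi d (X : measurableType d) (R : realType)
  (mu : set X -> \bar R) (h : R -> X -> X) (A : X -> R) (F : X -> R)
  (g ginv : X -> X) (n : nat) : set (R * (R * seqR R)) -> \bar R :=
  pushforward (nun mu h A g n) (Pphi F A g ginv).

Definition cn d (X : measurableType d) (R : realType)
  (mu : set X -> \bar R) (h : R -> X -> X) (A : X -> R) (g : X -> X) (n : nat) : R :=
  \prod_(j < n) fine (\int[nun mu h A g j]_y (A (g y))%:E).

(* d lambda_p^(n) = c_n / k_n^p * prod_{j=1}^n sigma_{-j}^(p-1) d nu_ominus^(n),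
   k_n = 2^n *)
Definition lambda_p d (X : measurableType d) (R : realType)
  (mu : set X -> \bar R) (h : R -> X -> X) (A : X -> R) (g ginv : X -> X)
  (p : R) (n : nat) : set (R * seqR R) -> \bar R :=
  fun E => (\int[nu_ominus mu h A g ginv n]_(z in E)
     ((cn mu h A g n / ((2 ^+ n) `^ p)) * \prod_(j < n) (z.2 j) `^ (p - 1))%:E)%E.

Definition Lambda_p d (X : measurableType d) (R : realType)
  (mu : set X -> \bar R) (h : R -> X -> X) (A : X -> R) (g ginv : X -> X)
  (p : R) (n : nat) : set (seqR R) -> \bar R :=
  pushforward (lambda_p mu h A g ginv p n) (@shiftS R).

(* Main.v *)
(* The measure nu^(n) = (g^n)_* nu is the image under P o g^n of mu reweighted by
   A o g^n.  Homogeneity of A gives A = 1 on Y and makes the multipliers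
   invariant under h^a, so at the point P (g^n x) the product of the sigma_{-j},
   1 <= j <= n, telescopes to A (g^n x) / A x.  Likewise c_n telescopes to
   int A o g^n dmu / int A dmu.  Hence the integral of any nonnegative function
   against lambda_p^(n) is an integral against mu with weight
   A (g^n x)^p A(x)^(1 - p) / (2^(np) int A dmu), and both identities become
   pointwise equalities of integrands over mu, thanks to the homogeneity of F
   for the first one and to P_- (P (g y)) = S (P_ominus (P y)) for the second. *)

Require Import Defs.
From HB Require Import structures.
From mathcomp Require Import all_boot all_order all_algebra.
From mathcomp Require Import all_classical all_reals all_analysis.
From mathcomp Require Import measurable_realfun ring.
Import Order.TTheory GRing.Theory Num.Theory.
Import numFieldNormedType.Exports.
Local Open Scope classical_set_scope.
Local Open Scope ring_scope.
Set Implicit Arguments. Unset Strict Implicit. Unset Printing Implicit Defensive.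

(** * Measures given by a density and integration against them *)

Section density.
Context d (T : measurableType d) (R : realType) (mu : {measure set T -> \bar R}).
Variable w : T -> R.
Hypotheses (mw : measurable_fun setT w) (w0 : forall x, 0 <= w x).
Local Open Scope ereal_scope.

Lemma density_is_measure :
  exists m : {measure set T -> \bar R},
    (fun E => \int[mu]_(x in E) (w x)%:E) = m :> (set T -> \bar R).
Proof.
pose m0 := fun E => \int[mu]_(x in E) (w x)%:E.
have m00 : m0 set0 = 0 by rewrite /m0 integral_set0.
have m0_ge0 E : 0 <= m0 E by apply: integral_ge0 => x _; rewrite lee_fin.
have m0_sigma : semi_sigma_additive m0.
  apply: semi_sigma_additive_nng_induced => [|x]; last by rewrite lee_fin.
  exact/measurable_EFinP.
pose mm := isMeasure.Build _ _ _ m0 m00 m0_ge0 m0_sigma.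
by exists (HB.pack_for {measure set T -> \bar R} m0 mm).
Qed.

Variable m : {measure set T -> \bar R}.
Hypothesis mE : forall E, measurable E -> m E = \int[mu]_(x in E) (w x)%:E.

Import HBNNSimple.

(** Monotone convergence along increasing nonnegative simple functions, applied on both sides,
    reduces the formula to indicators, where it is the hypothesis [mE]. Only agreement on measurable
    sets is asked of [m], so the same formula serves measures that are not literally defined by a
    density. *)
Lemma ge0_integral_density (f : T -> \bar R) :
  measurable_fun setT f -> (forall x, 0 <= f x) ->
  \int[m]_x f x = \int[mu]_x (f x * (w x)%:E).
Proof.
move=> mf f0.
have mwE : measurable_fun setT (EFin \o w) by exact/measurable_EFinP.
pose f_ := nnsfun_approx measurableT mf.
transitivity (limn (fun n => \int[m]_x (f_ n x)%:E)).
  rewrite -monotone_convergence//=.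
  - by apply: eq_integral => x _; apply/esym/cvg_lim => //; exact: cvg_nnsfun_approx.
  - by move=> n; exact/measurable_EFinP/measurable_funTS.
  - by move=> n x _; rewrite lee_fin.
  - by move=> x _ a b ab; rewrite lee_fin; exact/lefP/nd_nnsfun_approx.
transitivity (limn (fun n => \int[mu]_x ((f_ n x)%:E * (w x)%:E))); last first.
  rewrite -monotone_convergence//=.
  - apply: eq_integral => x _; rewrite muleC.
    under eq_fun do rewrite muleC.
    apply/cvg_lim => //; apply: cvgeZl => //; exact: cvg_nnsfun_approx.
  - by move=> n; apply: emeasurable_funM => //; exact/measurable_EFinP/measurable_funTS.
  - by move=> n x _; rewrite mule_ge0 ?lee_fin.
  - move=> x _ a b ab; rewrite lee_wpmul2r ?lee_fin//.
    exact/lefP/nd_nnsfun_approx.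
apply: congr_lim; apply/funext => n.
under [LHS]eq_integral do rewrite fimfunE -fsumEFin//.
rewrite [LHS]ge0_integral_fsum//; last 2 first.
  - by move=> r; exact/measurable_EFinP/measurableT_comp.
  - by move=> r x _; rewrite EFinM nnfun_muleindic_ge0.
under [RHS]eq_integral.
  move=> x _; rewrite fimfunE -fsumEFin// muleC ge0_mule_fsumr; last first.
    by move=> r; rewrite EFinM nnfun_muleindic_ge0.
  over.
rewrite [RHS]ge0_integral_fsum//; last 2 first.
  - move=> r; apply: emeasurable_funM => //.
    by apply/measurable_EFinP; exact: measurableT_comp.
  - by move=> r x _; rewrite mule_ge0 ?EFinM ?nnfun_muleindic_ge0 ?lee_fin.
apply: eq_fsbigr => r _.
have mr : measurable (f_ n @^-1` [set r]) by exact: measurable_sfunP.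
rewrite integralZl_indic_nnsfun//= integral_indic// setIT mE//.
(* A negative [r] is not a value of the nonnegative simple function, so its level set is empty and
   both sides vanish. *)
have [r0|r0] := leP 0%R r; last first.
  by rewrite preimage_nnfun0// integral_set0 mule0 integral0_eq// => x _; rewrite indic0 mulr0 mule0.
rewrite -ge0_integralZl//; last 2 first.
- exact: measurable_funTS.
- by move=> x _; rewrite lee_fin.
rewrite integral_mkcond; apply: eq_integral => x _.
rewrite patchE indicE; case: ifPn => _; first by rewrite mulr1 muleC.
by rewrite mulr0 mule0.
Qed.

End density.

(** * Reweighted probabilities and their push-forwards *)

Lemma integral_gt0_fine d (T : measurableType d) (R : realType)
    (m : probability T R) (B : T -> R) :
  measurable_fun setT B -> (forall x, 0 < B x) ->
  (\int[m]_x (B x)%:E < +oo)%E -> 0 < fine (\int[m]_x (B x)%:E).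
Proof.
move=> mB B0 Boo; apply: fine_gt0; rewrite Boo andbT.
rewrite lt0e integral_ge0 ?andbT; last by move=> x _; rewrite lee_fin ltW.
(* If the integral were zero, [B] would vanish almost everywhere; as [B] is positive, the whole
   space would then lie in a null set, against total mass 1. *)
apply/eqP => IB0.
have [|+ _] := ae_eq_integral_abs m measurableT (f := EFin \o B).
  exact/measurable_EFinP.
move=> /(_ _) []; first by rewrite -[RHS]IB0; apply: eq_integral => x _ /=; rewrite gtr0_norm.
move=> N [mN N0 sN].
have : m setT = 0.
  apply: (subset_measure0 measurableT mN) => // x _; apply: sN => /= /(_ I) [Bx].
  by have := B0 x; rewrite Bx ltxx.
by rewrite probability_setT => /eqP; rewrite onee_eq0.
Qed.

Lemma pushforward_probability d d' (T : measurableType d) (T' : measurableType d')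
    (R : realType) (m : probability T R) (f : T -> T') :
  measurable_fun setT f ->
  exists m' : probability T' R, pushforward m f = m' :> (set T' -> \bar R).
Proof.
move=> mf; pose f' : {mfun T >-> T'} := HB.pack f (isMeasurableFun.Build _ _ _ _ f mf).
by exists (distribution m f').
Qed.

(** [dens] is a bare set function. Exhibiting a bundled probability equal to it, together with its
    integration formula, lets later proofs rewrite with integration lemmas; the same format recurs
    below for [gstar], [nu0], [nun] and [lambda_p]. *)
Lemma dens_probability d (T : measurableType d) (R : realType)
    (m : probability T R) (B : T -> R) :
  measurable_fun setT B -> (forall x, 0 < B x) ->
  (\int[m]_x (B x)%:E < +oo)%E ->
  exists2 m' : probability T R, dens m B = m' :> (set T -> \bar R) &
    forall f : T -> \bar R, measurable_fun setT f -> (forall x, 0 <= f x)%E ->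
    (\int[m']_x f x =
      (fine (\int[m]_x (B x)%:E))^-1%:E * \int[m]_x (f x * (B x)%:E))%E.
Proof.
move=> mB B0 Boo; have I0 := integral_gt0_fine mB B0 Boo.
have Ifin : (\int[m]_x (B x)%:E)%E \is a fin_num.
  by rewrite ge0_fin_numE// integral_ge0// => x _; rewrite lee_fin ltW.
have [m1 m1E] := density_is_measure m mB (fun x => ltW (B0 x)).
have c0 : 0 <= (fine (\int[m]_x (B x)%:E))^-1 by rewrite invr_ge0 ltW.
pose m2 : {measure set T -> \bar R} := mscale (NngNum c0) m1.
have m2E : dens m B = m2 .
  by apply/funext => E; rewrite /dens; have /= -> := congr1 (@^~ E) m1E.
have m2T : (m2 setT = 1)%E.
  rewrite -m2E /dens -{2}(fineK Ifin) -EFinM mulVf//; exact: lt0r_neq0.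
pose m3 : probability T R := HB.pack (Measure.sort m2) (Measure_isProbability.Build _ _ _ m2 m2T).
exists m3 => // f mf f0.
rewrite (_ : (\int[m3]_x f x)%E = (\int[m2]_x f x)%E)//.
rewrite ge0_integral_mscale//=; congr *%E.
apply: ge0_integral_density => //; [by move=> x; exact: ltW | by move=> E _; rewrite -m1E].
Qed.

Lemma gstar_probability d (T : measurableType d) (R : realType)
    (m : probability T R) (A : T -> R) (P g : T -> T) :
  measurable_fun setT P -> measurable_fun setT g ->
  measurable_fun setT A -> (forall x, 0 < A x) ->
  (\int[m]_x (A (g x))%:E < +oo)%E ->
  exists2 m' : probability T R, gstar A P g m = m' :> (set T -> \bar R) &
    forall f : T -> \bar R, measurable_fun setT f -> (forall x, 0 <= f x)%E ->
    (\int[m']_x f x = (fine (\int[m]_x (A (g x))%:E))^-1%:E *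
                      \int[m]_x (f (P (g x)) * (A (g x))%:E))%E.
Proof.
move=> mP mg mA A0 Aoo.
have mAg : measurable_fun setT (A \o g) by exact: measurableT_comp.
have [m1 m1E Im1] := dens_probability mAg (fun x => A0 (g x)) Aoo.
have mPg : measurable_fun setT (P \o g) by exact: measurableT_comp.
have [m2 m2E] := pushforward_probability m1 mPg.
exists m2; first by rewrite -m2E -m1E.
move=> f mf f0; rewrite -m2E ge0_integral_pushforward//.
by rewrite preimage_setT Im1// => [|x]; [exact: measurableT_comp mPg|exact: f0].
Qed.

(** * Integration against a measure with a conditional density *)

Lemma ge0_integral_cond_density d (T : measurableType d) (R : realType)
    (D : set R) (m : probability (R * T)%type R) (nu : probability T R)
    (r : R -> T -> R) :
  measurable D -> measurable_fun setT (fun z : R * T => r z.1 z.2) ->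
  (forall x y, 0 <= r x y) ->
  (forall E, measurable E -> m E =
     \int[nu]_y \int[lebesgue_measure]_(x in [set x | D x /\ E (x, y)]) (r x y)%:E)%E ->
  forall f : R * T -> \bar R, measurable_fun setT f -> (forall z, 0 <= f z)%E ->
  (\int[m]_z f z =
   \int[nu]_y \int[lebesgue_measure]_(x in D) (f (x, y) * (r x y)%:E))%E.
Proof.
move=> mD mr r0 mE f mf f0.
(* [lebesgue_measure] lives on [measurableTypeR R], whose measurable structure
   has the same sets as that of [R] but a different display. *)
pose S : measurableType _ := (measurableTypeR R * T)%type.
have mi : measurable_fun [set: R * T] (id : R * T -> S).
  by move=> _ E mE'; rewrite setTI.
have [m' m'E] := pushforward_probability m mi.
have -> : (\int[m]_z f z = \int[m']_z f z)%E.
  by rewrite -m'E ge0_integral_pushforward.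
(* Extending the conditional density by zero outside [D] allows integration over the full product
   space. *)
pose w (z : S) : R := r z.1 z.2 * \1_D z.1.
have w0 z : 0 <= w z by rewrite mulr_ge0.
have mw : measurable_fun setT w.
  apply: measurable_funM => //.
  by apply: (measurableT_comp _ measurable_fst); exact: measurable_indic.
have patchw (h : S -> \bar R) y :
    (\int[lebesgue_measure]_x (h (x, y) * (w (x, y))%:E) =
     \int[lebesgue_measure]_(x in D) (h (x, y) * (r x y)%:E))%E.
  rewrite [RHS]integral_mkcond epatch_indic.
  by apply: eq_integral => x _ /=; rewrite /w/= EFinM muleA.
pose mu : {measure set S -> \bar R} := (lebesgue_measure \x nu)%E.
(* By Tonelli, the hypothesis on [m] says that [w] is a density with respect to the product of
   Lebesgue measure and [nu]. The density formula and a second use of Tonelli then give the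
   claim. *)
have mEw (E : set S) : measurable E -> (m' E = \int[mu]_(z in E) (w z)%:E)%E.
  move=> measE; rewrite -m'E /pushforward mE//.
  rewrite /mu [RHS]integral_mkcond epatch_indic/= fubini_tonelli2/=; last 2 first.
  - apply: emeasurable_funM; first exact/measurable_EFinP.
    exact/measurable_EFinP/measurable_indic.
  - by move=> z; rewrite mule_ge0// lee_fin.
  apply: eq_integral => y _; rewrite /fubini_G/=.
  under [RHS]eq_integral do rewrite muleC.
  rewrite (patchw (EFin \o \1_E)) integral_mkcondr epatch_indic.
  by apply: eq_integral => x _ /=; rewrite muleC.
rewrite (ge0_integral_density mw w0 mEw)// /mu fubini_tonelli2/=; last 2 first.
- by apply: emeasurable_funM => //; exact/measurable_EFinP.
- by move=> z; rewrite mule_ge0// lee_fin.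
by apply: eq_integral => y _; rewrite /fubini_G/= patchw.
Qed.

Lemma measurable_fun_lebesgue_section d (T : measurableType d) (R : realType)
    (D : set R) (f : R * T -> \bar R) :
  measurable D -> measurable_fun setT f -> (forall z, 0 <= f z)%E ->
  measurable_fun setT (fun y => \int[lebesgue_measure]_(x in D) f (x, y))%E.
Proof.
move=> mD mf f0; pose S : measurableType _ := (measurableTypeR R * T)%type.
pose fD (z : S) : \bar R := (f z * (\1_D z.1)%:E)%E.
rewrite (_ : (fun _ => _) = fubini_G lebesgue_measure fD).
  apply: measurable_fun_fubini_tonelli_G => [|z]; last first.
    by rewrite mule_ge0// lee_fin.
  apply: emeasurable_funM => //; apply/measurable_EFinP.
  by apply: (measurableT_comp _ measurable_fst); exact: measurable_indic.
apply/funext => y; rewrite /fubini_G [LHS]integral_mkcond epatch_indic.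
by apply: eq_integral.
Qed.

(** * Measurability in the sequence space *)

Lemma measurable_fun_seqR d (T : measurableType d) (R : realType)
    (f : T -> seqR R) :
  (forall i, measurable_fun setT (fun x => f x i)) -> measurable_fun setT f.
Proof.
move=> mf; apply: (@measurability _ _ _ (seqR R) setT f (@coord_sets R)) => //.
by move=> _ [_ [i [B [mB ->]]] <-]; exact: (mf i measurableT B mB).
Qed.

Lemma measurable_coord (R : realType) (i : nat) :
  measurable_fun setT (fun s : seqR R => s i).
Proof.
move=> _ B mB; rewrite setTI; apply: sub_sigma_algebra.
by exists i, B.
Qed.

Lemma measurable_shiftS (R : realType) : measurable_fun setT (@shiftS R).
Proof.
apply: measurable_fun_seqR => -[|i] /=; first exact: measurable_fst.
exact: (measurableT_comp (measurable_coord i) measurable_snd).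
Qed.

Lemma prod_powR (R : realType) (I : Type) (s : seq I) (f : I -> R) (q : R) :
  (forall i, 0 <= f i) ->
  \prod_(i <- s) f i `^ q = (\prod_(i <- s) f i) `^ q.
Proof.
move=> f0; elim: s => [|i s IHs]; first by rewrite !big_nil powR1.
by rewrite !big_cons IHs powRM// prodr_ge0.
Qed.

(** * Algebra of the multipliers along the orbits of [g] *)

Section renormalization.
Context d (X : measurableType d) (R : realType) (mu : probability X R).
Variables (h : R -> X -> X) (A : X -> R) (g ginv : X -> X).
Local Notation P := (Pmap h A).
Hypothesis hM : forall a b x, 0 < a -> 0 < b -> h a (h b x) = h (a * b) x.
Hypothesis A0 : forall x, 0 < A x.
Hypothesis Ah : forall a x, 0 < a -> A (h a x) = A x / a.
Hypothesis gh : forall a x, 0 < a -> g (h a x) = h a (g x).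
Hypothesis ginvh : forall a x, 0 < a -> ginv (h a x) = h a (ginv x).
Hypothesis gK : cancel g ginv.

Lemma iterg_h n a x : 0 < a -> iter n g (h a x) = h a (iter n g x).
Proof. by move=> a0; elim: n => // n IHn; rewrite /= IHn gh. Qed.

Lemma gpow_h k a x : 0 < a -> gpow g ginv k (h a x) = h a (gpow g ginv k x).
Proof.
move=> a0; case: k => n; first exact: iterg_h.
by elim: n => [|n IHn]; rewrite /= ?ginvh//; move: IHn => /= ->; rewrite ginvh.
Qed.

Lemma gpow_g k x : gpow g ginv k (g x) = gpow g ginv (k + 1) x.
Proof.
case: k => n; first by rewrite -PoszD addn1 /= -iterSr.
rewrite /= -iterS iterSr gK NegzE; case: n => [|n]; first by rewrite addNr.
by rewrite intS opprD addrAC addNr add0r -NegzE.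
Qed.

(** Both values of [A] in the quotient are divided by the same [a]. *)
Lemma sigmaZ_h k a x : 0 < a -> sigmaZ A g ginv k (h a x) = sigmaZ A g ginv k x.
Proof.
move=> a0; rewrite /sigmaZ !gpow_h// !Ah// -mulf_div divff ?mulr1//.
by rewrite invr_neq0// gt_eqF.
Qed.

Lemma sigmaZ_g k x : sigmaZ A g ginv k (g x) = sigmaZ A g ginv (k + 1) x.
Proof. by rewrite /sigmaZ !gpow_g. Qed.

Lemma sigmaZ_P k x : sigmaZ A g ginv k (P x) = sigmaZ A g ginv k x.
Proof. exact: sigmaZ_h. Qed.

Lemma sigmaZ_gt0 k x : 0 < sigmaZ A g ginv k x.
Proof. exact: divr_gt0. Qed.

Lemma A_iter_P n x : A (iter n g (P x)) = A (iter n g x) / A x.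
Proof. by rewrite /Pmap iterg_h// Ah. Qed.

(** Since [g] commutes with the maps [h a], projecting before iterating only moves the endpoint
    along its [h]-orbit, and the final [P] forgets this: the scalings by [A x] and by
    [A (iter n g x) / A x] compose to [A (iter n g x)]. *)
Lemma P_iter_P n x : P (iter n g (P x)) = P (iter n g x).
Proof.
rewrite {1}/Pmap A_iter_P [iter n g (P x)]iterg_h// hM//; last exact: divr_gt0.
by rewrite divfK// gt_eqF.
Qed.

Lemma Pominus_P x : Pominus A g ginv (P x) = Pominus A g ginv x.
Proof.
congr pair; first exact: sigmaZ_P.
by apply/funext => j; exact: sigmaZ_P.
Qed.

(** Applying [g] raises the index of every multiplier by one, and the two projections by [P] leave
    the multipliers unchanged. This is the source of the shift in the recursion. *)
Lemma Pminus_Pg x : Pminus A g ginv (P (g x)) = shiftS (Pominus A g ginv (P x)).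
Proof.
rewrite Pominus_P; apply/funext => -[|j] /=.
  by rewrite /Pminus sigmaZ_P sigmaZ_g addNr.
rewrite /Pminus sigmaZ_P sigmaZ_g; congr sigmaZ.
by rewrite [Posz j.+2]intS opprD addrAC addNr add0r.
Qed.

Lemma prod_sigmaZ n x :
  \prod_(j < n) (Pominus A g ginv (P (iter n g x))).2 j = A (iter n g x) / A x.
Proof.
elim: n => [|n IHn]; first by rewrite big_ord0 divff// gt_eqF.
(* The factor at index 0 is the newest multiplier, with numerator [A (iter n.+1 g x)]; the others
   are the multipliers of the previous iterate, shifted by one place. *)
rewrite big_ord_recl [X in _ * X](_ : _ = A (iter n g x) / A x).
  by rewrite /= Pminus_Pg/= sigmaZ_P /sigmaZ/= mulrA divfK// gt_eqF.
rewrite -IHn; apply: eq_bigr => j _.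
by rewrite /= Pminus_Pg.
Qed.


(** * Measurability and the normalizing masses *)

Hypotheses (mA : measurable_fun setT A) (mP : measurable_fun setT P).
Hypotheses (mg : measurable_fun setT g) (mginv : measurable_fun setT ginv).
Hypothesis Aoo : forall n, (\int[mu]_x (A (iter n g x))%:E < +oo)%E.

Let mass n : R := fine (\int[mu]_x (A (iter n g x))%:E)%E.

Lemma measurable_iterg n : measurable_fun setT (iter n g).
Proof. by elim: n => [|n IHn]; [exact: measurable_id|exact: measurableT_comp mg IHn]. Qed.

Lemma measurable_gpow k : measurable_fun setT (gpow g ginv k).
Proof.
case: k => n; first exact: measurable_iterg.
by elim: n => [|n IHn]; [exact: mginv|exact: measurableT_comp mginv IHn].
Qed.

Lemma measurable_sigmaZ k : measurable_fun setT (sigmaZ A g ginv k).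
Proof.
have mAk j : measurable_fun setT (fun x => A (gpow g ginv j x)).
  exact: measurableT_comp mA (measurable_gpow j).
apply: measurable_funM => //.
(* The inverse is written as a real power, whose measurability is available on the whole line. *)
rewrite (_ : (fun _ => _) = (fun x => A (gpow g ginv k x) `^ (-1))).
  exact: (measurableT_comp (measurable_powR (-1)) (mAk k)).
by apply/funext => x; rewrite powR_inv1// ltW.
Qed.

Lemma measurable_Pminus : measurable_fun setT (Pminus A g ginv).
Proof. by apply: measurable_fun_seqR => i; exact: measurable_sigmaZ. Qed.

Lemma measurable_Pominus : measurable_fun setT (Pominus A g ginv).
Proof.
apply: measurable_fun_pair; [exact: measurable_sigmaZ|exact: measurable_Pminus].
Qed.

Lemma mass_gt0 n : 0 < mass n.
Proof.
apply: integral_gt0_fine => //.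
exact: measurableT_comp mA (measurable_iterg n).
Qed.

Lemma massE n : (\int[mu]_x (A (iter n g x))%:E)%E = (mass n)%:E.
Proof.
rewrite fineK// ge0_fin_numE ?Aoo// integral_ge0// => x _.
by rewrite lee_fin ltW.
Qed.

(** * The measures [nun] and the constants [cn] in terms of [mu] *)

Lemma nu0_probability :
  exists2 m : probability X R, nu0 mu h A = m :> (set X -> \bar R) &
    forall f : X -> \bar R, measurable_fun setT f -> (forall x, 0 <= f x)%E ->
    (\int[m]_x f x = (mass 0)^-1%:E * \int[mu]_x (f (P x) * (A x)%:E))%E.
(* The measure [nu0] has the form of [gstar] for the identity map, applied to [mu]. *)
Proof. by apply: (@gstar_probability _ _ _ mu A P id) => //; exact: (Aoo 0). Qed.

(** The reweightings by [A] and by [A] after [g^n] merge into one: at [P x] the second weight is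
    [A (iter n g x) / A x], so the factor [A x] cancels, and [mass 0] cancels in the
    normalization. *)
Lemma nun_probability n :
  exists2 m : probability X R, nun mu h A g n = m :> (set X -> \bar R) &
    forall f : X -> \bar R, measurable_fun setT f -> (forall x, 0 <= f x)%E ->
    (\int[m]_x f x = (mass n)^-1%:E *
                     \int[mu]_x (f (P (iter n g x)) * (A (iter n g x))%:E))%E.
Proof.
have [m0 m0E Im0] := nu0_probability.
have mAn : measurable_fun setT (fun x => A (iter n g x)).
  exact: measurableT_comp mA (measurable_iterg n).
have mAnE : measurable_fun setT (fun x => (A (iter n g x))%:E).
  exact/measurable_EFinP.
have AnE : (\int[m0]_x (A (iter n g x))%:E = (mass n / mass 0)%:E)%E.
  rewrite Im0//; last by move=> x; rewrite lee_fin ltW.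
  rewrite mulrC EFinM -massE; congr (_ * _)%E.
  apply: eq_integral => x _; rewrite A_iter_P -EFinM divfK// gt_eqF//.
have [|||||m mE Im] := @gstar_probability _ _ _ m0 A P (iter n g).
- by [].
- exact: measurable_iterg.
- by [].
- by [].
- by rewrite AnE ltry.
exists m; first by rewrite -mE -m0E.
move=> f mf f0; rewrite Im// AnE/= Im0; last 2 first.
- apply: emeasurable_funM => //.
  by apply: measurableT_comp => //; apply: measurableT_comp mP (measurable_iterg n).
- by move=> x; rewrite mule_ge0// lee_fin ltW.
rewrite muleA -EFinM invf_div mulrAC divff ?mul1r ?gt_eqF ?mass_gt0//.
congr (_ * _)%E; apply: eq_integral => x _.
by rewrite -muleA -EFinM P_iter_P A_iter_P divfK// gt_eqF.
Qed.

(** The factor with index [j] equals [mass j.+1 / mass j], so the product telescopes. *)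
Lemma cnE n : cn mu h A g n = mass n / mass 0.
Proof.
rewrite /cn; elim: n => [|n IHn]; first by rewrite big_ord0 divff// gt_eqF// mass_gt0.
rewrite big_ord_recr/= IHn; have [m -> ->] := nun_probability n; last 2 first.
- by apply/measurable_EFinP; exact: measurableT_comp mA mg.
- by move=> x; rewrite lee_fin ltW.
rewrite (_ : (\int[mu]_x _)%E = (mass n.+1)%:E); last first.
  rewrite -massE; apply: eq_integral => x _; rewrite -EFinM /Pmap gh// Ah//.
  by rewrite divfK// gt_eqF.
by rewrite -EFinM/= mulrACA divff ?gt_eqF ?mass_gt0// mul1r mulrC.
Qed.

(** * The measures [lambda_p] and [Lambda_p] as weighted integrals over [mu] *)

Variable p : R.

(** Density of [lambda_p] with respect to [nu_ominus], as a function of the past multipliers alone,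
    so that it can leave integrals over the present multiplier. *)
Let weight n (s : seqR R) : R :=
  (cn mu h A g n / (2 ^+ n) `^ p) * \prod_(j < n) (s j) `^ (p - 1).

Let weight_ge0 n s : 0 <= weight n s.
Proof.
rewrite mulr_ge0 ?prodr_ge0// ?divr_ge0 ?powR_ge0// => [|j _]; last exact: powR_ge0.
by rewrite cnE divr_ge0 ?ltW ?mass_gt0.
Qed.

Let measurable_weight n : measurable_fun setT (weight n).
Proof.
apply: measurable_funM => //; apply: measurable_prod => j _.
exact: (measurableT_comp (measurable_powR (p - 1)) (measurable_coord j)).
Qed.

(** Density against [mu] obtained when [lambda_p] is pulled back to [X]. *)
Let v n x : R :=
  (mass 0)^-1 * (2 ^+ n) `^ (- p) * (A (iter n g x) `^ p * A x `^ (1 - p)).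

Let weightE n x :
  (mass n)^-1 * (weight n (Pminus A g ginv (P (iter n g x))) * A (iter n g x)) =
  v n x.
Proof.
rewrite /weight prod_powR; last by move=> j; rewrite ltW ?sigmaZ_gt0.
rewrite [X in X `^ (p - 1)](prod_sigmaZ n x) cnE /v powRN.
set a := A (iter n g x); have a0 : 0 < a by exact: A0.
have aN0 : a != 0 by rewrite gt_eqF.
have xN0 : A x != 0 by rewrite gt_eqF.
rewrite powRM ?invr_ge0 ?(ltW (A0 x)) ?(ltW a0)//.
(* The telescoped product raised to [p - 1] leaves [A x] with exponent [1 - p]; next, the extra
   factor [a] turns [a] to the power [p - 1] into [a] to the power [p]. *)
rewrite -(powR_inv1 (ltW (A0 x))) -powRrM mulN1r opprB.
have -> : a `^ p = a `^ (p - 1) * a.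
  by rewrite -[X in _ * X](powRr1 (ltW a0)) -powRD ?subrK// aN0 implybT.
have mn0 : mass n != 0 by rewrite gt_eqF ?mass_gt0.
have m00 : mass 0 != 0 by rewrite gt_eqF ?mass_gt0.
have k0 : (2 ^+ n : R) `^ p != 0 by rewrite gt_eqF// powR_gt0// exprn_gt0.
by field; rewrite k0 mn0 m00.
Qed.

Lemma ge0_integral_nun_weight n (f : X -> \bar R) :
  measurable_fun setT f -> (forall x, 0 <= f x)%E ->
  (\int[nun mu h A g n]_y (f y * (weight n (Pminus A g ginv y))%:E) =
   \int[mu]_x (f (P (iter n g x)) * (v n x)%:E))%E.
Proof.
move=> mf f0; have [m -> Im] := nun_probability n.
have mw := measurableT_comp (measurable_weight n) measurable_Pminus.
have mPn := measurableT_comp mP (measurable_iterg n).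
rewrite Im; last 2 first.
- by apply: emeasurable_funM => //; exact/measurable_EFinP.
- by move=> y; rewrite mule_ge0// lee_fin.
rewrite -ge0_integralZl//; last 3 first.
- apply: emeasurable_funM; first apply: emeasurable_funM.
  + exact: (measurableT_comp mf mPn).
  + by apply/measurable_EFinP; exact: (measurableT_comp mw mPn).
  + by apply/measurable_EFinP; exact: (measurableT_comp mA (measurable_iterg n)).
- by move=> x _; rewrite !mule_ge0// lee_fin// ltW.
- by rewrite lee_fin invr_ge0 ltW ?mass_gt0.
apply: eq_integral => x _; rewrite -weightE (EFinM _^-1) (EFinM (weight _ _)).
by rewrite -(muleA (f _)) (muleCA (mass n)^-1%:E).
Qed.

Lemma ge0_integral_pushforward_nun n d' (T : measurableType d') (q : X -> T)
    (f : T -> \bar R) :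
  measurable_fun setT q -> measurable_fun setT f -> (forall z, 0 <= f z)%E ->
  (\int[pushforward (nun mu h A g n) q]_z f z =
   \int[nun mu h A g n]_y f (q y))%E.
Proof.
move=> mq mf f0; have [m -> _] := nun_probability n.
by rewrite ge0_integral_pushforward// preimage_setT.
Qed.

Lemma nu_ominus_probability n :
  exists m : probability (R * seqR R)%type R,
    nu_ominus mu h A g ginv n = m :> (set (R * seqR R) -> \bar R).
Proof.
have [m mE _] := nun_probability n; rewrite /nu_ominus mE.
exact: pushforward_probability measurable_Pominus.
Qed.

Lemma nu_minus_probability n :
  exists m : probability (seqR R) R,
    nu_minus mu h A g ginv n = m :> (set (seqR R) -> \bar R).
Proof.
have [m mE _] := nun_probability n; rewrite /nu_minus mE.
exact: pushforward_probability measurable_Pminus.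
Qed.

Lemma lambda_density n :
  lambda_p mu h A g ginv p n =
  (fun E => \int[nu_ominus mu h A g ginv n]_(z in E) (weight n z.2)%:E)%E.
Proof. by []. Qed.

Let measurable_weight2 n :
  measurable_fun setT (fun z : R * seqR R => weight n z.2).
Proof. exact: (measurableT_comp (measurable_weight n) measurable_snd). Qed.

Lemma lambda_measure n :
  exists2 m : {measure set (R * seqR R) -> \bar R},
    lambda_p mu h A g ginv p n = m :> (set (R * seqR R) -> \bar R) &
    forall f, measurable_fun setT f -> (forall z, 0 <= f z)%E ->
    (\int[m]_z f z =
     \int[nu_ominus mu h A g ginv n]_z (f z * (weight n z.2)%:E))%E.
Proof.
rewrite lambda_density; have [mo ->] := nu_ominus_probability n.
have w0 (z : R * seqR R) : 0 <= weight n z.2 by exact: weight_ge0.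
have [m mE] := density_is_measure mo (measurable_weight2 n) w0.
exists m => // f mf f0; apply: ge0_integral_density => // E _.
by rewrite -mE.
Qed.

Lemma ge0_integral_lambda n (f : R * seqR R -> \bar R) :
  measurable_fun setT f -> (forall z, 0 <= f z)%E ->
  (\int[lambda_p mu h A g ginv p n]_z f z =
   \int[mu]_x (f (Pominus A g ginv (P (iter n g x))) * (v n x)%:E))%E.
Proof.
move=> mf f0; have [m -> ->//] := lambda_measure n.
rewrite ge0_integral_pushforward_nun; last 3 first.
- exact: measurable_Pominus.
- by apply: emeasurable_funM => //; exact/measurable_EFinP.
- by move=> z; rewrite mule_ge0// lee_fin.
rewrite (ge0_integral_nun_weight n (f := f \o Pominus A g ginv))// => [|y].
  exact: measurableT_comp mf measurable_Pominus.
exact: f0.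
Qed.

(** The shift moves the sequence argument on to the iterate [n.+1] while the weight stays [v n];
    [vS] below supplies the ratio of consecutive weights. *)
Lemma ge0_integral_Lambda n (f : seqR R -> \bar R) :
  measurable_fun setT f -> (forall s, 0 <= f s)%E ->
  (\int[Lambda_p mu h A g ginv p n]_s f s =
   \int[mu]_x (f (Pminus A g ginv (P (iter n.+1 g x))) * (v n x)%:E))%E.
Proof.
move=> mf f0; have [m mE _] := lambda_measure n.
have mfS := measurableT_comp mf (@measurable_shiftS R).
rewrite /Lambda_p mE ge0_integral_pushforward//; last exact: measurable_shiftS.
rewrite preimage_setT.
have := ge0_integral_lambda n mfS (fun z => f0 (shiftS z)); rewrite mE => ->.
by apply: eq_integral => x _ /=; rewrite -Pminus_Pg//.
Qed.

Let vS n x :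
  2 `^ (- p) * Pminus A g ginv (P (iter n.+1 g x)) 0%N `^ p * v n x = v n.+1 x.
Proof.
have -> : Pminus A g ginv (P (iter n.+1 g x)) 0%N =
    A (iter n.+1 g x) / A (iter n g x).
  by rewrite /Pminus sigmaZ_P sigmaZ_g addNr.
rewrite powRM ?invr_ge0 ?(ltW (A0 _))// -(powR_inv1 (ltW (A0 (iter n g x)))).
rewrite -powRrM mulN1r /v exprS (@powRM _ 2) ?exprn_ge0//.
have a0 : A (iter n g x) `^ p != 0 by rewrite gt_eqF// powR_gt0.
have m0 : mass 0 != 0 by rewrite gt_eqF ?mass_gt0.
have k0 (y : R) : 0 < y -> y `^ p != 0 by move=> ?; rewrite gt_eqF// powR_gt0.
by rewrite !powRN; field; rewrite a0 m0 !k0// exprn_gt0.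
Qed.

(** * The recursion for [lambda_p], with both sides reduced to [mu] *)

Lemma lambda_recursion n (r : R -> seqR R -> R) :
  measurable_fun setT (fun z : R * seqR R => r z.1 z.2) ->
  (forall x s, 0 <= r x s) ->
  (forall E : set (R * seqR R), measurable E ->
     nu_ominus mu h A g ginv n.+1 E =
     \int[nu_minus mu h A g ginv n.+1]_s
       \int[lebesgue_measure]_(x in [set x : R | (0 < x)%R /\ E (x, s)])
         (r x s)%:E)%E ->
  forall E : set (R * seqR R), measurable E ->
  (lambda_p mu h A g ginv p n.+1 E =
   \int[Lambda_p mu h A g ginv p n]_s
     \int[lebesgue_measure]_(x in [set x : R | (0 < x)%R /\ E (x, s)])
       (2 `^ (- p) * (s 0%N) `^ p * r x s)%:E)%E.
Proof.
move=> mr r0 rE E mE.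
pose D := [set x : R | 0 < x].
have mD : measurable D by rewrite /D -set_itvoy; exact: measurable_itv.
pose Er (z : R * seqR R) : \bar R := ((\1_E z)%:E * (r z.1 z.2)%:E)%E.
have mEr : measurable_fun setT Er.
  apply: emeasurable_funM; last exact/measurable_EFinP.
  exact/measurable_EFinP/measurable_indic.
have Er0 z : (0 <= Er z)%E by rewrite mule_ge0// lee_fin.
pose H s := (\int[lebesgue_measure]_(x in D) Er (x, s))%E.
have mH : measurable_fun setT H by exact: measurable_fun_lebesgue_section.
have H0 s : (0 <= H s)%E by exact: integral_ge0.
have HZ c s : 0 <= c ->
    (\int[lebesgue_measure]_(x in D) (c%:E * Er (x, s)) = c%:E * H s)%E.
  move=> c0; apply: ge0_integralZl => //; apply: measurable_funTS.
  exact: (measurable_fun_pair1 s mEr).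
have [mo moE] := nu_ominus_probability n.+1.
have [mm mmE] := nu_minus_probability n.+1.
(* The conditional density is inserted at level [n.+1]; the weight does not involve the present
   multiplier and leaves the inner integral. *)
transitivity (\int[nu_minus mu h A g ginv n.+1]_s (H s * (weight n.+1 s)%:E))%E.
  rewrite lambda_density moE integral_mkcond epatch_indic.
  rewrite (@ge0_integral_cond_density _ _ _ D mo mm r)//; last 3 first.
  - by move=> E' mE'; rewrite -moE -mmE; exact: rE.
  - apply: emeasurable_funM; first exact/measurable_EFinP.
    exact/measurable_EFinP/measurable_indic.
  - by move=> z; rewrite mule_ge0// lee_fin.
  rewrite mmE; apply: eq_integral => s _; rewrite muleC -HZ//.
  by apply: eq_integral => x _; rewrite /Er/= muleA.
rewrite /nu_minus ge0_integral_pushforward_nun; last 3 first.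
- exact: measurable_Pminus.
- by apply: emeasurable_funM => //; exact/measurable_EFinP.
- by move=> s; rewrite mule_ge0// lee_fin.
rewrite (ge0_integral_nun_weight n.+1 (f := H \o Pminus A g ginv)); last 2 first.
- exact: measurableT_comp mH measurable_Pminus.
- by move=> y; exact: H0.
pose c (s : seqR R) : R := 2 `^ (- p) * (s 0%N) `^ p.
have c0 s : 0 <= c s by rewrite mulr_ge0 ?powR_ge0.
have mc : measurable_fun setT c.
  apply: measurable_funM => //.
  exact: (measurableT_comp (measurable_powR p) (measurable_coord 0)).
transitivity (\int[Lambda_p mu h A g ginv p n]_s ((c s)%:E * H s))%E.
  rewrite ge0_integral_Lambda; last 2 first.
  - by apply: emeasurable_funM => //; exact/measurable_EFinP.
  - by move=> s; rewrite mule_ge0// lee_fin.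
  apply: eq_integral => x _.
  by rewrite -vS [in LHS]EFinM -[RHS]muleA muleCA.
(* It remains to put the factor [c s] back under the inner integral. *)
congr integral; apply/funext => s; rewrite -(HZ (c s) s (c0 s)).
transitivity (\int[lebesgue_measure]_(x in D `&` [set x | E (x, s)])
    (c s * r x s)%:E)%E; last by [].
rewrite integral_mkcondr epatch_indic; apply: eq_integral => x _.
by rewrite /Er/= muleCA muleC EFinM.
Qed.

Lemma lambda0 (E : set (R * seqR R)) : measurable E ->
  lambda_p mu h A g ginv p 0 E = nu_ominus mu h A g ginv 0 E.
Proof.
move=> mE; rewrite /lambda_p; have [m ->] := nu_ominus_probability 0.
rewrite (eq_integral (cst 1%E)) ?integral_cst ?mul1e// => z _.
by rewrite /cn !big_ord0 expr0 powR1 divr1 mulr1.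
Qed.

(** * The moment identity, first for nonnegative functions of [F] *)

Section moments.
Variables (F : X -> R) (r : R -> R * seqR R -> R) (n : nat).
Hypotheses (mF : measurable_fun setT F)
  (Fh : forall a x, 0 < a -> F (h a x) = F x / a `^ p).
Hypotheses (mr : measurable_fun setT (fun w : R * (R * seqR R) => r w.1 w.2))
  (r0 : forall f z, 0 <= r f z).
Hypothesis rE : forall E : set (R * (R * seqR R)), measurable E ->
  (nu_phi mu h A F g ginv n E =
   \int[nu_ominus mu h A g ginv n]_z
     \int[lebesgue_measure]_(f in [set f : R | E (f, z)]) (r f z)%:E)%E.

Let mean (u : R -> R) (z : R * seqR R) : \bar R :=
  (\int[lebesgue_measure]_f (u f * r f z)%:E)%E.

Let measurable_mean (u : R -> R) : measurable_fun setT u -> (forall f, 0 <= u f) ->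
  measurable_fun setT (mean u).
Proof.
move=> mu0 u0; apply: (measurable_fun_lebesgue_section (D := setT)
  (f := fun w : R * (R * seqR R) => (u w.1 * r w.1 w.2)%:E)) => //.
- apply/measurable_EFinP; apply: measurable_funM => //.
  exact: (measurableT_comp mu0 measurable_fst).
- by move=> w; rewrite lee_fin mulr_ge0.
Qed.

Let mean_ge0 (u : R -> R) : (forall f, 0 <= u f) -> forall z, (0 <= mean u z)%E.
Proof. by move=> u0 z; apply: integral_ge0 => f _; rewrite lee_fin mulr_ge0. Qed.

(** Positive homogeneity of [u] transfers the scaling law of [F] to [u] composed with [F], which is
    all the comparison over [mu] requires. The lemma is meant for the positive and negative parts of
    a real number. *)
Lemma ge0_moment_lambda (u : R -> R) :
  measurable_fun setT u -> (forall f, 0 <= u f) ->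
  (forall c f, 0 < c -> u (f * c) = u f * c) ->
  (((2 ^+ n) `^ (- p))%:E * \int[nu0 mu h A]_y (u (F (iter n g y)))%:E =
   \int[lambda_p mu h A g ginv p n]_z mean u z)%E.
Proof.
move=> measu u0 uM.
have muF k : measurable_fun setT (fun x => (u (F (iter k g x)))%:E).
  apply/measurable_EFinP; apply: (measurableT_comp measu).
  exact: measurableT_comp mF (measurable_iterg k).
transitivity (\int[mu]_x (u (F (P (iter n g x))) * v n x)%:E)%E.
  have [m0 -> Im0] := nu0_probability.
  rewrite Im0//; last by move=> x; rewrite lee_fin.
  rewrite muleA -EFinM -ge0_integralZl//; last 3 first.
  - apply: emeasurable_funM; last exact/measurable_EFinP.
    exact: (measurableT_comp (muF n) mP).
  - by move=> x _; rewrite mule_ge0// lee_fin// ltW.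
  - by rewrite lee_fin mulr_ge0 ?powR_ge0// invr_ge0 ltW ?mass_gt0.
  apply: eq_integral => x _; rewrite -!EFinM /Pmap iterg_h// !Fh//.
  have k0 (y : R) : 0 < y -> 0 < (y `^ p)^-1 by move=> ?; rewrite invr_gt0 powR_gt0.
  rewrite !uM ?k0// /v; congr EFin.
  rewrite (_ : A x `^ (1 - p) = A x / A x `^ p); last first.
    by rewrite -powRN powRD ?powRr1// ?ltW// (gt_eqF (A0 x)) implybT.
  have Ap0 : A (iter n g x) `^ p != 0 by rewrite gt_eqF// powR_gt0.
  have Ax0 : A x `^ p != 0 by rewrite gt_eqF// powR_gt0.
  have m0' : mass 0 != 0 by rewrite gt_eqF ?mass_gt0.
  by field; rewrite Ap0 Ax0 m0'.
have [ml mlE Iml] := lambda_measure n.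
rewrite mlE Iml; [|exact: measurable_mean|exact: mean_ge0].
have [mo moE] := nu_ominus_probability n.
have mPphi : measurable_fun setT (Pphi F A g ginv).
  by apply: measurable_fun_pair => //; exact: measurable_Pominus.
have [mp mpE] : exists m : probability (R * (R * seqR R))%type R,
    nu_phi mu h A F g ginv n = m :> (set _ -> \bar R).
  have [m mE _] := nun_probability n; rewrite /nu_phi mE.
  exact: pushforward_probability mPphi.
pose f (w : R * (R * seqR R)) : \bar R := ((u w.1)%:E * (weight n w.2.2)%:E)%E.
have mf : measurable_fun setT f.
  apply: emeasurable_funM; apply/measurable_EFinP.
    exact: (measurableT_comp measu measurable_fst).
  exact: (measurableT_comp (measurable_weight2 n) measurable_snd).
have f0 w : (0 <= f w)%E by rewrite mule_ge0// lee_fin.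
(* Both sides pass through the joint law of [F] and the multipliers: the left one by pulling back to
   [mu], the right one by disintegrating along [rE]. *)
transitivity (\int[nu_phi mu h A F g ginv n]_w f w)%E.
  rewrite ge0_integral_pushforward_nun//.
  rewrite (ge0_integral_nun_weight n (f := fun y => (u (F y))%:E))// => [|y].
    exact: (muF 0).
  by rewrite lee_fin.
rewrite mpE (@ge0_integral_cond_density _ _ _ setT mp mo r)//; last first.
  move=> E mE; rewrite -mpE rE// moE; apply: eq_integral => z _.
  by congr integral; apply/seteqP; split => // x [].
rewrite moE; apply: eq_integral => z _; rewrite muleC /mean -ge0_integralZl//.
- by apply: eq_integral => x _; rewrite /f/= muleAC muleC EFinM.
- apply/measurable_EFinP; apply: measurable_funM => //.
  exact: (measurable_fun_pair1 z mr).
- by move=> x _; rewrite lee_fin mulr_ge0.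
- by rewrite lee_fin.
Qed.

Lemma moment_lambda :
  (nu0 mu h A).-integrable setT (fun y => (F (iter n g y))%:E) ->
  (((2 ^+ n) `^ (- p))%:E * \int[nu0 mu h A]_y (F (iter n g y))%:E =
   \int[lambda_p mu h A g ginv p n]_z
     \int[lebesgue_measure]_f (f * r f z)%:E)%E.
Proof.
have [m0 m0E _] := nu0_probability; have [ml mlE _] := lambda_measure n.
rewrite m0E => iF.
pose up (f : R) := Num.max f 0; pose un (f : R) := Num.max (- f) 0.
have mup : measurable_fun setT up by exact: measurable_maxr.
have mun : measurable_fun setT un.
  by apply: measurable_maxr => //; exact: measurable_oppr.
have up0 f : 0 <= up f by rewrite le_max lexx orbT.
have un0 f : 0 <= un f by rewrite le_max lexx orbT.
have upM c f : 0 < c -> up (f * c) = up f * c.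
  by move=> c0; rewrite /up maxr_pMl ?mul0r// ltW.
have unM c f : 0 < c -> un (f * c) = un f * c.
  by move=> c0; rewrite /un maxr_pMl ?mul0r ?mulNr// ltW.
have Ip := ge0_moment_lambda mup up0 upM.
have In := ge0_moment_lambda mun un0 unM.
have Fp : (fun y => (F (iter n g y))%:E)^\+%E = fun y => (up (F (iter n g y)))%:E.
  by apply/funext => y; rewrite funeposE -EFin_max.
have Fn : (fun y => (F (iter n g y))%:E)^\-%E = fun y => (un (F (iter n g y)))%:E.
  by apply/funext => y; rewrite funenegE -EFinN -EFin_max.
have meanE : (fun z => \int[lebesgue_measure]_f (f * r f z)%:E)%E =
             (mean up \- mean un)%E.
  (* This holds at every [z], even where both parts are infinite, because the integral is by
     definition the difference of the integrals of the two parts. *)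
  apply/funext => z; rewrite integralE.
  congr (_ - _)%E; apply: eq_integral => f _.
    by rewrite funeposE -EFin_max /up maxr_pMl ?mul0r.
  by rewrite funenegE -EFinN -EFin_max /un maxr_pMl ?mul0r ?mulNr.
rewrite meanE.
rewrite m0E in Ip In.
have Fpoo := integrable_funepos measurableT iF.
have Fnoo := integrable_funeneg measurableT iF.
have Ipfin := integrable_fin_num measurableT Fpoo.
have Infin := integrable_fin_num measurableT Fnoo.
rewrite Fp in Ipfin; rewrite Fn in Infin.
(* Integrability of [F] after [g^n] makes both one-sided moments finite; by the nonnegative identity
   both means are then integrable and may be subtracted. *)
have mean_integrable (u : R -> R) : measurable_fun setT u -> (forall f, 0 <= u f) ->
    (\int[ml]_z mean u z \is a fin_num)%E -> ml.-integrable setT (mean u).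
  move=> measu u0 Iu; apply/integrableP; split; first exact: measurable_mean.
  under eq_integral do rewrite gee0_abs ?mean_ge0//.
  by rewrite -ge0_fin_numE// integral_ge0// => z _; exact: mean_ge0.
rewrite mlE in Ip In; rewrite mlE.
rewrite integralB//; last 2 first.
- by apply: mean_integrable => //; rewrite -Ip fin_numM.
- by apply: mean_integrable => //; rewrite -In fin_numM.
by rewrite -Ip -In [in LHS]integralE Fp Fn muleBr// fin_num_adde_defr.
Qed.

End moments.

End renormalization.

(** * Derivation of the theorem from its standing hypotheses *)

Unset Implicit Arguments.

Theorem theorem4
  (R : realType) (d : measure_display) (X : measurableType d)
  (Phi : R -> X -> X) (mu : probability X R) (h : R -> X -> X)
  (G : set (X -> X)) (Y : set X) (A : X -> R)
  (g ginv : X -> X) (p : R) (F : X -> R)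
  (rho0 : nat -> R -> seqR R -> R) (rhoF : nat -> R -> R * seqR R -> R)
  (* the flow Phi^t *)
  (hPhi : forall t, bijective (Phi t) /\ measurable_fun setT (Phi t))
  (hPhiD : forall t1 t2, Phi t1 \o Phi t2 = Phi (t1 + t2))
  (hPhim : measurable_fun setT (fun xt : X * R => Phi xt.2 xt.1))
  (* invariant probability measure *)
  (hmu : forall t E, measurable E -> mu (Phi t @^-1` E) = mu E)
  (* the maps h^a, a > 0 *)
  (hh : forall a, 0 < a -> bijective (h a) /\ measurable_fun setT (h a))
  (hhM : forall a1 a2, 0 < a1 -> 0 < a2 -> h a1 \o h a2 = h (a1 * a2))
  (* the group G and the commutation relations *)
  (hG : is_group_of_bij_meas G)
  (hGPhi : forall t g', G g' -> Phi t \o g' = g' \o Phi t)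
  (hGh : forall a g', 0 < a -> G g' -> g' \o h a = h a \o g')
  (hPhih : forall t a, 0 < a -> Phi t \o h a = h a \o Phi (t / a))
  (* the representative set Y and the function A *)
  (hAm : measurable_fun setT A)
  (hApos : forall x, 0 < A x)
  (hY : forall x, Y (h (A x) x))
  (hYuniq : forall x a, 0 < a -> Y (h a x) -> a = A x)
  (hAint : (\int[mu]_x (A x)%:E < +oo)%E)
  (hPm : measurable_fun setT (Pmap h A))
  (* standing assumption *)
  (hAG : forall g', G g' -> (\int[mu]_x (A (g' x))%:E < +oo)%E)
  (* the fixed g in G, with inverse ginv *)
  (hg : G g) (hginv : cancel g ginv /\ cancel ginv g)
  (* the function F, homogeneous of degree -p *)
  (hFm : measurable_fun setT F)
  (hFh : forall a x, 0 < a -> F (h a x) = F x / a `^ p)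
  (* the conditional densities *)
  (hrho0m : forall n, measurable_fun setT (fun z : R * seqR R => rho0 n z.1 z.2))
  (hrho0 : forall n s0 s, 0 <= rho0 n s0 s)
  (hrho0d : forall n (E : set (R * seqR R)), measurable E ->
     nu_ominus mu h A g ginv n E =
     (\int[nu_minus mu h A g ginv n]_s
        (\int[lebesgue_measure]_(s0 in [set s0 : R | (0 < s0)%R /\ E (s0, s)])
            (rho0 n s0 s)%:E))%E)
  (hrhoFm : forall n, measurable_fun setT
              (fun w : R * (R * seqR R) => rhoF n w.1 w.2))
  (hrhoF : forall n f z, 0 <= rhoF n f z)
  (hrhoFd : forall n (E : set (R * (R * seqR R))), measurable E ->
     nu_phi mu h A F g ginv n E =
     (\int[nu_ominus mu h A g ginv n]_z
        (\int[lebesgue_measure]_(f in [set f : R | E (f, z)]) (rhoF n f z)%:E))%E) :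
  (* N_p(k_n) = int f rho_F^(n)(f | sigma_ominus) df d lambda_p^(n)(sigma_ominus) *)
  (forall n : nat,
     (nu0 mu h A).-integrable setT (fun y => (F (iter n g y))%:E) ->
     (((2 ^+ n) `^ (- p))%:E * \int[nu0 mu h A]_y (F (iter n g y))%:E =
      \int[lambda_p mu h A g ginv p n]_z
         (\int[lebesgue_measure]_f (f * rhoF n f z)%:E))%E)
  /\
  (* lambda_p^(0) = nu_ominus^(0) *)
  (forall E : set (R * seqR R), measurable E ->
     lambda_p mu h A g ginv p 0 E = nu_ominus mu h A g ginv 0 E)
  /\
  (* recursion for lambda_p^(n+1) *)
  (forall (n : nat) (E : set (R * seqR R)), measurable E ->
     lambda_p mu h A g ginv p n.+1 E =
     (\int[Lambda_p mu h A g ginv p n]_s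
        (\int[lebesgue_measure]_(s0 in [set s0 : R | (0 < s0)%R /\ E (s0, s)])
            (2 `^ (- p) * (s 0%N) `^ p * rho0 n.+1 s0 s)%:E))%E).
Proof.
have hM a b x : 0 < a -> 0 < b -> h a (h b x) = h (a * b) x.
  by move=> a0 b0; rewrite -hhM.
(* Scaling [h a x] by [A x / a] gives [P x], which lies in [Y], so uniqueness of the representative
   identifies the factor. *)
have Ah a x : 0 < a -> A (h a x) = A x / a.
  move=> a0; symmetry; apply: hYuniq; first exact: divr_gt0.
  rewrite hM ?divr_gt0// divfK; first exact: hY.
  by rewrite gt_eqF.
have [G1 GM GV Gbij] := hG; have [gK ginvK] := hginv.
(* The given inverse coincides with the one provided by the group, so it commutes with [h] and is
   measurable. *)
have Gginv : G ginv.
  have [g2 Gg2 [gK2 g2K]] := GV _ hg.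
  rewrite (_ : ginv = g2)//; apply/funext => x.
  by rewrite -[in LHS](g2K x) gK.
have comm_h g' (Gg' : G g') a x : 0 < a -> g' (h a x) = h a (g' x).
  by move=> a0; have /= -> := congr1 (@^~ x) (hGh a g' a0 Gg').
have [_ mg] := Gbij _ hg; have [_ mginv] := Gbij _ Gginv.
have Aoo n : (\int[mu]_x (A (iter n g x))%:E < +oo)%E.
  apply: hAG; elim: n => [|n IHn]; first exact: G1.
  exact: (GM g (iter n g)).
have gh := comm_h g hg; have ginvh := comm_h ginv Gginv.
split; [|split].
- by move=> n; apply: moment_lambda => //; exact: hrhoFd.
- by move=> E mE; apply: lambda0.
- by move=> n E mE; apply: lambda_recursion => //; exact: hrho0d.
Qed.
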